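(* Let $(\mathcal{D},\mathcal{L},\mathcal{R})$ be the port-Hamiltonian model of a circuit with conductances, inductances, capacitances and sources given in the context. Let functions of time $q,\psi_L,q_C,\phi,i_L,u_C,i_R,u_R,i_S,u_S$ on an interval satisfy the dynamics of $(\mathcal{D},\mathcal{L},\mathcal{R})$, i.e., for all $t$, \[ \begin{aligned} &\left(-\tfrac{d}{dt}q(t),-\tfrac{d}{dt}\psi_L(t),-\tfrac{d}{dt}q_C(t),-i_R(t),-i_S(t),\phi(t),i_L(t),u_C(t),u_R(t),u_S(t)\right)\in\mathcal{D}, \\ &(q(t),\psi_L(t),q_C(t),\phi(t),i_L(t),u_C(t))\in\mathcal{L},\qquad(-i_R(t),u_R(t))\in\mathcal{R}. \end{aligned} \] Then the following hold for all $t$. (a) \[ \begin{aligned} A_C\tfrac{d}{dt}q_C(t)+A_Rg(A_R^\top\phi(t))+A_Li_L(t)+A_Si_S(t)&=0, \\ -A_L^\top\phi(t)+\tfrac{d}{dt}\psi_L(t)&=0, \\ -A_S^\top\phi(t)+u_S(t)&=0, \\ A_C^\top\phi(t)-\nabla H_C(q_C(t))&=0, \\ i_L(t)-\nabla H_L(\psi_L(t))&=0. \end{aligned} \] (b) If, additionally, $\nabla H_C\in C^1(\mathbb{R}^{m_C},\mathbb{R}^{m_C})$ and $\nabla H_L\in C^1(\mathbb{R}^{m_L},\mathbb{R}^{m_L})$ are homeomorphisms with inverses $Q_C:=(\nabla H_C)^{-1}\in C(\mathbb{R}^{m_C},\mathbb{R}^{m_C})$ and $\Psi_L:=(\nabla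 H_L)^{-1}\in C(\mathbb{R}^{m_L},\mathbb{R}^{m_L})$, then $q_C(t)=Q_C(u_C(t))$ and $\psi_L(t)=\Psi_L(i_L(t))$. Splitting the source variables into current and voltage sources as $A_S=\begin{bmatrix}A_I&A_V\end{bmatrix}$, $u_S=\begin{pmatrix} u_I \\ u_V \end{pmatrix}$, $i_S=\begin{pmatrix} i_I \\ i_V \end{pmatrix}$, the equations of the charge/flux-oriented modified nodal analysis hold: \[ \begin{aligned} A_C\tfrac{d}{dt}q_C(t)+A_Rg(u_R(t))+A_Li_L(t)+A_Ii_I(t)+A_Vi_V(t)&=0, \\ -A_L^\top\phi(t)+\tfrac{d}{dt}\psi_L(t)&=0, \\ -A_V^\top\phi(t)+u_V(t)&=0, \\ q_C(t)-Q_C(A_C^\top\phi(t))&=0, \\ \psi_L(t)-\Psi_L(i_L(t))&=0. \end{aligned} \] (c) If, in addition to the assumptions of (b), $Q_C\in C^1(\mathbb{R}^{m_C},\mathbb{R}^{m_C})$ and $\Psi_L\in C^1(\mathbb{R}^{m_L},\mathbb{R}^{m_L})$, with Jacobians $\mathcal{C}(u_C):=\frac{\mathrm{d}}{\mathrm{d}u_C}Q_C(u_C)$ and $\mathscr{L}(i_L):=\frac{\mathrm{d}}{\mathrm{d}i_L}\Psi_L(i_L)$, then the charge/flux-oriented equations in (b) can be reformulated to obtain the equations of the modified nodal analysis: \[ \begin{aligned} A_C\,\mathcal{C}(A_C^\top\phi(t))\,A_C^\top\tfrac{d}{dt}\phi(t)+A_Rg(A_R^\top\phi(t))+A_Li_L(t)+A_Ii_I(t)+A_Vi_V(t)&=0,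 \\ -A_L^\top\phi(t)+\mathscr{L}(i_L(t))\tfrac{d}{dt}i_L(t)&=0, \\ -A_V^\top\phi(t)+u_V(t)&=0. \end{aligned} \]
   Context: Let $N,m_R,m_L,m_C,m_S$ be nonnegative integers and $m=m_R+m_L+m_C+m_S$. Let $A=\begin{bmatrix}A_R&A_L&A_C&A_S\end{bmatrix}\in\mathbb{R}^{N\times m}$ be the matrix obtained from the incidence matrix of the circuit graph (finite, directed, loop-free, $n$ vertices, $m$ edges) by deleting the rows corresponding to a set $S$ of grounded vertices containing at most one vertex per connected component ($N=n-|S|$); the blocks $A_R,A_L,A_C,A_S$ have $m_R,m_L,m_C,m_S$ columns and correspond to the edges of conductances, inductances, capacitances and sources. Incidence matrix convention: entry $1$ at $(v,e)$ if $v$ is the initial vertex of $e$, $-1$ if $v$ is its terminal vertex, $0$ otherwise. Let $g:\mathbb{R}^{m_R}\to\mathbb{R}^{m_R}$ satisfy $u^\top g(u)\ge0$ for all $u$, and let $H_L\in C^1(\mathbb{R}^{m_L},\mathbb{R})$, $H_C\in C^1(\mathbb{R}^{m_C},\mathbb{R})$. (If the circuit is built from individual components, $g$ is the stacked map of the individual conductance functions and $H_L$, $H_C$ are the sums of the individual energy functions.) The port-Hamiltonian model of the circuit is the triple $(\mathcal{D},\mathcal{L},\mathcal{R})$ with \[ \begin{aligned} \mathcal{D}=\Big\{&(j,-u_L,-i_C,-i_R,-i_S,\phi,i_L,u_C,u_R,u_S)\in\mathbb{R}^{N}\times\mathbb{R}^m\times\mathbb{R}^{N}\times\mathbb{R}^m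 \;\Big| \\ &\begin{bmatrix} I&0&A_C&A_R&A_S \\ 0&0&0&0&0 \\ 0&-I&0&0&0 \\ 0&0&0&0&0 \\ 0&0&0&0&0 \end{bmatrix}\begin{pmatrix} j \\ -u_L \\ -i_C \\ -i_R \\ -i_S \end{pmatrix}+\begin{bmatrix} 0&-A_L&0&0&0 \\ -A_R^\top&0&0&I&0 \\ -A_L^\top&0&0&0&0 \\ -A_C^\top&0&I&0&0 \\ -A_S^\top&0&0&0&I \end{bmatrix}\begin{pmatrix} \phi \\ i_L \\ u_C \\ u_R \\ u_S \end{pmatrix}=0\Big\}, \end{aligned} \] \[ \mathcal{L}=\{(q,\psi_L,q_C,\phi,i_L,u_C)\in(\mathbb{R}^{N}\times\mathbb{R}^{m_L}\times\mathbb{R}^{m_C})^2\mid q=0,\ i_L=\nabla H_L(\psi_L),\ u_C=\nabla H_C(q_C)\}, \] \[ \mathcal{R}=\{(-i_R,u_R)\in\mathbb{R}^{m_R}\times\mathbb{R}^{m_R}\mid i_R=g(u_R)\}. \] No solvability or regularity theory for the time functions is considered; the time derivatives written in the equations are understood to exist. *)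

(* Defs.v *)
From HB Require Import structures.
From mathcomp Require Import all_boot all_order all_algebra.
From mathcomp Require Import all_classical all_reals all_analysis.

Set Implicit Arguments.
Unset Strict Implicit.
Unset Printing Implicit Defensive.

Import Order.TTheory GRing.Theory Num.Theory.
Import numFieldNormedType.Exports.

Local Open Scope classical_set_scope.
Local Open Scope ring_scope.

(* Vectors of R^n are column vectors 'cV[R]_n; every dimension may be 0. *)

Section Blocks.
Variable R : realType.

Definition row4 p n1 n2 n3 n4 (a : 'M[R]_(p, n1)) (b : 'M[R]_(p, n2))
    (c : 'M[R]_(p, n3)) (d : 'M[R]_(p, n4)) : 'M[R]_(p, n1 + (n2 + (n3 + n4))) :=
  row_mx a (row_mx b (row_mx c d)).

Definition row5 p n1 n2 n3 n4 n5 (a : 'M[R]_(p, n1)) (b : 'M[R]_(p, n2))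
    (c : 'M[R]_(p, n3)) (d : 'M[R]_(p, n4)) (e : 'M[R]_(p, n5)) :
    'M[R]_(p, n1 + (n2 + (n3 + (n4 + n5)))) :=
  row_mx a (row4 b c d e).

Definition col5 p n1 n2 n3 n4 n5 (a : 'M[R]_(n1, p)) (b : 'M[R]_(n2, p))
    (c : 'M[R]_(n3, p)) (d : 'M[R]_(n4, p)) (e : 'M[R]_(n5, p)) :
    'M[R]_(n1 + (n2 + (n3 + (n4 + n5))), p) :=
  col_mx a (col_mx b (col_mx c (col_mx d e))).

End Blocks.

(* Finite directed loop-free graph with vertices 'I_n and edges 'I_m;
   parallel edges are allowed. *)
Record digraph (n m : nat) := Digraph {
  edge_init : 'I_m -> 'I_n;
  edge_term : 'I_m -> 'I_n;
  edge_loopless : forall e, edge_init e != edge_term e }.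

Section Graph.
Variables (n m : nat) (G : digraph n m).

Definition adjacent : rel 'I_n := fun u v =>
  [exists e, ((edge_init G e == u) && (edge_term G e == v))
          || ((edge_init G e == v) && (edge_term G e == u))].

Definition grounding (S : {set 'I_n}) : Prop :=
  forall u v, u \in S -> v \in S -> connect adjacent u v -> u = v.

Definition incidence (R : realType) : 'M[R]_(n, m) :=
  \matrix_(v, e) (if v == edge_init G e then 1
                  else if v == edge_term G e then -1 else 0).

(* The rows of the vertices in S are deleted; the remaining N = #|~: S| rows
   keep their order. *)
Definition reduced_incidence (R : realType) (S : {set 'I_n}) :
    'M[R]_(#|~: S|, m) :=
  rowsub (fun i : 'I_#|~: S| => enum_val i) (incidence R).

End Graph.

Section Calculus.
Variable R : realType.

Definition grad n (H : 'cV[R]_n -> R) (x : 'cV[R]_n) : 'cV[R]_n :=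
  \col_i 'D_(delta_mx i 0) H x.

(* The library's 'J is for row vectors acting from the left; this is the usual
   Jacobian matrix, acting on column vectors. *)
Definition jac n p (F : 'cV[R]_n -> 'cV[R]_p) (x : 'cV[R]_n) : 'M[R]_(p, n) :=
  \matrix_(i, j) 'D_(delta_mx j 0) (fun y => F y i 0) x.

Definition C1_scalar n (H : 'cV[R]_n -> R) : Prop :=
  (forall x, differentiable H x) /\ continuous (grad H).

Definition C1 n p (F : 'cV[R]_n -> 'cV[R]_p) : Prop :=
  (forall x, differentiable F x) /\ continuous (jac F).

Definition homeomorphism_with_inverse n (F Finv : 'cV[R]_n -> 'cV[R]_n) : Prop :=
  [/\ continuous F, continuous Finv, cancel F Finv & cancel Finv F].

(* An interval of positive length: open, closed or half-open, bounded or not. *)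
Definition time_interval (I : set R) : Prop :=
  is_interval I /\ exists a b, [/\ I a, I b & a < b].

(* Time derivatives are taken relative to I, so that they are one-sided at an
   endpoint of I belonging to I, and only the values on I matter. *)
Definition derivable_on (I : set R) n (x : R -> 'cV[R]_n) (t : R) : Prop :=
  cvg ((fun h => h^-1 *: (x (h + t) - x t)) @ within [set h | I (h + t)] 0^').

Definition ddt (I : set R) n (x : R -> 'cV[R]_n) (t : R) : 'cV[R]_n :=
  lim ((fun h => h^-1 *: (x (h + t) - x t)) @ within [set h | I (h + t)] 0^').

Lemma ddt_interior (I : set R) n (x : R -> 'cV[R]_n) (t : R) :
  interior I t -> ddt I x t = derive1 x t.
Proof.
move=> It; rewrite /ddt /derive1.
suff -> : within [set h | I (h + t)] 0^' = 0^' :> set_system R by [].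
have I0 : \forall h \near (0 : R)^', I (h + t).
  apply: cvg_within.
  have : (fun h : R => h + t) @ (0 : R) --> 0 + t.
    by apply: cvgD; [exact: cvg_id|exact: cvg_cst].
  by rewrite add0r; apply.
apply/seteqP; split => P /= HP; last by apply: filterS HP.
by apply: filterS2 I0 HP => h Ih /(_ Ih).
Qed.

End Calculus.

Section PortHamiltonian.
Variable R : realType.

Section Structures.
Variables (N mR mL mC mS : nat).
Variables (A_R : 'M[R]_(N, mR)) (A_L : 'M[R]_(N, mL)).
Variables (A_C : 'M[R]_(N, mC)) (A_S : 'M[R]_(N, mS)).

Definition dirac_flow_mx :
    'M[R]_(N + (mR + (mL + (mC + mS))), N + (mL + (mC + (mR + mS)))) :=
  col5 (row5 1%:M 0        A_C A_R A_S)
       (row5 0    0        0   0   0)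
       (row5 0    (- 1%:M) 0   0   0)
       (row5 0    0        0   0   0)
       (row5 0    0        0   0   0).

Definition dirac_effort_mx :
    'M[R]_(N + (mR + (mL + (mC + mS))), N + (mL + (mC + (mR + mS)))) :=
  col5 (row5 0         (- A_L) 0    0    0)
       (row5 (- A_R^T) 0       0    1%:M 0)
       (row5 (- A_L^T) 0       0    0    0)
       (row5 (- A_C^T) 0       1%:M 0    0)
       (row5 (- A_S^T) 0       0    0    1%:M).

(* Pairs (f, e) with f = (j, -u_L, -i_C, -i_R, -i_S) and
   e = (phi, i_L, u_C, u_R, u_S), each stacked into one column. *)
Definition circuit_dirac :
    set ('cV[R]_(N + (mL + (mC + (mR + mS))))
         * 'cV[R]_(N + (mL + (mC + (mR + mS))))) :=
  [set fe | dirac_flow_mx *m fe.1 + dirac_effort_mx *m fe.2 = 0].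

Definition circuit_lagrange (H_L : 'cV[R]_mL -> R) (H_C : 'cV[R]_mC -> R) :
    set (('cV[R]_N * 'cV[R]_mL * 'cV[R]_mC)
         * ('cV[R]_N * 'cV[R]_mL * 'cV[R]_mC)) :=
  [set xe | let: ((q, psi_L, q_C), (phi, i_L, u_C)) := xe in
     [/\ q = 0, i_L = grad H_L psi_L & u_C = grad H_C q_C]].

(* Pairs (-i_R, u_R) with i_R = g u_R. *)
Definition circuit_resistive (g : 'cV[R]_mR -> 'cV[R]_mR) :
    set ('cV[R]_mR * 'cV[R]_mR) :=
  [set fe | - fe.1 = g fe.2].

End Structures.

Definition satisfies_dynamics (N mR mL mC mS : nat) (I : set R)
    (D : set ('cV[R]_(N + (mL + (mC + (mR + mS))))
              * 'cV[R]_(N + (mL + (mC + (mR + mS))))))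
    (L : set (('cV[R]_N * 'cV[R]_mL * 'cV[R]_mC)
              * ('cV[R]_N * 'cV[R]_mL * 'cV[R]_mC)))
    (Res : set ('cV[R]_mR * 'cV[R]_mR))
    (q : R -> 'cV[R]_N) (psi_L : R -> 'cV[R]_mL) (q_C : R -> 'cV[R]_mC)
    (phi : R -> 'cV[R]_N) (i_L : R -> 'cV[R]_mL) (u_C : R -> 'cV[R]_mC)
    (i_R u_R : R -> 'cV[R]_mR) (i_S u_S : R -> 'cV[R]_mS) : Prop :=
  forall t, I t ->
  [/\ [/\ derivable_on I q t, derivable_on I psi_L t & derivable_on I q_C t],
      D (col5 (- ddt I q t) (- ddt I psi_L t) (- ddt I q_C t)
              (- i_R t) (- i_S t),
         col5 (phi t) (i_L t) (u_C t) (u_R t) (u_S t)),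
      L ((q t, psi_L t, q_C t), (phi t, i_L t, u_C t)) &
      Res (- i_R t, u_R t)].

End PortHamiltonian.

(* Main.v *)
Require Import Defs.
From HB Require Import structures.
From mathcomp Require Import all_boot all_order all_algebra.
From mathcomp Require Import all_classical all_reals all_analysis.
From mathcomp Require Import ring lra.

Set Implicit Arguments.
Unset Strict Implicit.
Unset Printing Implicit Defensive.

Import Order.TTheory GRing.Theory Num.Theory.
Import numFieldNormedType.Exports.

Local Open Scope classical_set_scope.
Local Open Scope ring_scope.

(** On the interval q vanishes identically, so its relative derivative is 0 and
    the first row of the Dirac relation is Kirchhoff's current law; the other
    rows give Kirchhoff's voltage law.  Part (c) is the chain rule for one-sided
    derivatives: q_C = Q_C (A_C^T phi) yields the capacitive term, while
    i_L = grad H_L (psi_L) is differentiable because grad H_L is, and then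
    psi_L = Psi_L (i_L) is differentiated. *)

(** * Time derivatives relative to an interval, and their chain rule *)

Section RelativeTimeDerivative.
Variable R : realType.
Implicit Types (I : set R) (t : R).

(** With [diff_quot], this unfolds to the expression inside [ddt] and [derivable_on], so facts about
    either apply by conversion. *)
Definition rel_nbhs I t : set_system R := within [set h | I (h + t)] 0^'.

Definition diff_quot n (x : R -> 'cV[R]_n) t (h : R) : 'cV[R]_n :=
  h^-1 *: (x (h + t) - x t).

#[local] Instance rel_nbhs_filter I t : Filter (rel_nbhs I t).
Proof. exact: within_filter. Qed.

(* Properness is what makes the limit defining [ddt] unique: an interval of
   positive length has no isolated point. *)
Lemma rel_nbhs_proper I t :
  time_interval I -> I t -> ProperFilter (rel_nbhs I t).
Proof.
move=> [itvI [a [b [Ia Ib ltab]]]] It; apply: Build_ProperFilter_ex.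
rewrite /rel_nbhs /within /= => P /nbhs_ballP [e /= e0 eP].
(* Moving from [t] a fraction [s] of the way towards a second point [c] of [I] stays in [I] by
   convexity. *)
have [c Ic nect] : exists2 c, I c & c != t.
  have [<-|] := eqVneq a t; first by exists b => //; rewrite gt_eqF.
  by move=> ?; exists a.
pose k := c - t.
have k0 : k != 0 by rewrite subr_eq0.
(* The bound 1 keeps [s * k + t] between [t] and [c]; the other bound gives a step of size at most
   [e / 2]. *)
pose s : R := Num.min 1 (e / (2 * `|k|)).
have nk0 : 0 < `|k| by rewrite normr_gt0.
have s0 : 0 < s by rewrite lt_min ltr01 divr_gt0 // mulr_gt0.
have s1 : s <= 1 by rewrite ge_min lexx.
exists (s * k); apply: eP => /=.
- rewrite /ball /= sub0r normrN normrM gtr0_norm //.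
  have : s * `|k| <= e / (2 * `|k|) * `|k|.
    by rewrite ler_wpM2r // ge_min lexx orbT.
  by move/le_lt_trans; apply; rewrite invfM mulrA mulfVK ?gt_eqF //; lra.
- by rewrite mulf_neq0 // gt_eqF.
- have -> : s * k + t = s * c + (1 - s) * t by rewrite /k; ring.
  have [ltct|ltct] : c < t \/ t < c by apply/orP; rewrite -neq_lt.
  + by apply: (itvI c t) => //; nra.
  + by apply: (itvI t c) => //; nra.
Qed.

Lemma rel_nbhs_in I t : \forall h \near rel_nbhs I t, I (h + t).
Proof. exact: withinT. Qed.

Lemma rel_nbhs_neq0 I t : \forall h \near rel_nbhs I t, h != 0.
Proof. by apply: cvg_within; exact: withinT. Qed.

Lemma rel_nbhs_cvg0 I t : (fun h : R => h) @ rel_nbhs I t --> (0 : R).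
Proof. by move=> P P0; apply: cvg_within; apply: cvg_within. Qed.

Lemma cvg_ddt I n (x : R -> 'cV[R]_n) t (v : 'cV[R]_n) :
  time_interval I -> I t ->
  diff_quot x t @ rel_nbhs I t --> v -> derivable_on I x t /\ ddt I x t = v.
Proof.
move=> itvI It xv; split; first by apply/cvg_ex; exists v.
have ? := rel_nbhs_proper itvI It.
exact: cvg_lim xv.
Qed.

(** The filter only sees [h] with [I (h + t)], and [I t] takes care of the base point, so values
    outside [I] do not matter. *)
Lemma eq_cvg_diff_quot I n (x y : R -> 'cV[R]_n) t (v : 'cV[R]_n) :
  I t -> (forall s, I s -> x s = y s) ->
  diff_quot x t @ rel_nbhs I t --> v -> diff_quot y t @ rel_nbhs I t --> v.
Proof.
move=> It xy xv; refine (cvg_trans _ xv); apply: near_eq_cvg.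
by apply: filterS (rel_nbhs_in I t) => h Ih; rewrite /diff_quot !xy.
Qed.

(** The increment of [x] is [h] times its difference quotient. The linear part of [F] thus
    contributes ['d F] of a convergent quotient, and the little-o remainder, divided by [h],
    vanishes because that quotient stays bounded. *)
Lemma cvg_diff_quot_comp I n p (F : 'cV[R]_n -> 'cV[R]_p) (x : R -> 'cV[R]_n)
    t (v : 'cV[R]_n) :
  differentiable F (x t) -> diff_quot x t @ rel_nbhs I t --> v ->
  diff_quot (F \o x) t @ rel_nbhs I t --> 'd F (x t) v.
Proof.
move=> dF xv; set a := x t.
pose k h := x (h + t) - a.
have kE h : h != 0 -> k h = h *: diff_quot x t h.
  by move=> h0; rewrite /diff_quot scalerA divff // scale1r.
have k0 : k @ rel_nbhs I t --> (0 : 'cV[R]_n).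
  rewrite -(scale0r v).
  refine (cvg_trans _ (cvgZ (@rel_nbhs_cvg0 I t) xv)); apply: near_eq_cvg.
  by apply: filterS (rel_nbhs_neq0 I t) => h h0; rewrite kE.
have dFv : (fun h => 'd F a (diff_quot x t h)) @ rel_nbhs I t --> 'd F a v.
  have cdF : continuous ('d F a) by exact: diff_continuous.
  by refine (@continuous_cvg _ _ _ _ _ _ ('d F a) v _ xv); exact: cdF.
rewrite -[X in _ --> X]addr0.
pose rem h := diff_quot (F \o x) t h - 'd F a (diff_quot x t h).
rewrite (_ : diff_quot (F \o x) t = fun h => 'd F a (diff_quot x t h) + rem h);
  last by apply/funext => h; rewrite addrC subrK.
apply: cvgD => //.
apply/cvgr0Pnorm_le => e e0.
(* The quotient of [x] eventually has norm at most [|v| + 1], so a remainder of at most [d] times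
   the increment gives exactly [e] after division by [h]. *)
pose d := e / (`|v| + 1).
have d0 : 0 < d by rewrite divr_gt0 // ltr_wpDl.
have rem_le : \forall y \near (0 : 'cV[R]_n),
    `|F (y + a) - F a - 'd F a y| <= d * `|y|.
  have /eqaddoP /(_ d d0) := diff_locally dF.
  apply: filterS => y /=; rewrite !fctE /=.
  by rewrite opprD addrA.
have bnd : \forall h \near rel_nbhs I t, `|diff_quot x t h| <= `|v| + 1.
  move/cvgrPdist_le : xv => /(_ 1 ltr01); apply: filterS => h.
  rewrite distrC -lerBlDl; apply: le_trans; exact: lerB_dist.
have rem_le' : \forall h \near rel_nbhs I t,
    `|F (k h + a) - F a - 'd F a (k h)| <= d * `|k h| by exact: (k0 _ rem_le).
apply: filterS3 rem_le' bnd (rel_nbhs_neq0 I t) => h h1 h2 h0.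
have kK : k h + a = x (h + t) by rewrite /k subrK.
rewrite kK in h1.
have -> : rem h = h^-1 *: (F (x (h + t)) - F a - 'd F a (k h)).
  by rewrite /rem scalerBr linearZ.
rewrite normrZ normfV ler_pdivrMl ?normr_gt0 //.
apply: (le_trans h1); rewrite kE // normrZ mulrCA ler_pM2l ?normr_gt0 //.
apply: le_trans (ler_wpM2l (ltW d0) h2) _.
by rewrite /d divfK // gt_eqF // ltr_wpDl.
Qed.

(** On the basis of elementary matrices the product is a finite sum of continuous coordinates times
    constant matrices. *)
Lemma mulmx_continuous m n p (A : 'M[R]_(m, n)) :
  continuous (mulmx A : 'M[R]_(n, p) -> 'M[R]_(m, p)).
Proof.
move=> B.
have mulE : mulmx A = fun C : 'M[R]_(n, p) =>
    \sum_(ij <- index_enum ('I_n * 'I_p)%type)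
      C ij.1 ij.2 *: (A *m delta_mx ij.1 ij.2).
  apply/funext => C; rewrite {1}[C]matrix_sum_delta pair_bigA mulmx_sumr.
  by apply: eq_bigr => ij _; rewrite -scalemxAr.
have sumB (r : seq ('I_n * 'I_p)) :
    (fun C : 'M[R]_(n, p) =>
       \sum_(ij <- r) C ij.1 ij.2 *: (A *m delta_mx ij.1 ij.2)) @ B -->
    \sum_(ij <- r) B ij.1 ij.2 *: (A *m delta_mx ij.1 ij.2).
  elim: r => [|ij r IHr].
    rewrite big_nil (_ : (fun _ => _) = cst 0); first exact: cst_continuous.
    by apply/funext => C; rewrite big_nil.
  under eq_fun do rewrite big_cons; rewrite big_cons.
  refine (@cvgD _ _ _ (nbhs B) _ _ _ _ _ _ IHr).
  refine (@cvgZr_tmp _ _ _ (nbhs B) _ _ _ _ _).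
  exact: coord_continuous.
by rewrite mulE; exact: sumB.
Qed.

(** By linearity it suffices to treat basis vectors, where the differential is a directional
    derivative, computed entrywise. *)
Lemma diff_jac n p (F : 'cV[R]_n -> 'cV[R]_p) (x v : 'cV[R]_n) :
  differentiable F x -> 'd F x v = jac F x *m v.
Proof.
move=> dF; rewrite [in LHS](matrix_sum_delta v) linear_sum.
apply/colP => i; rewrite summxE mxE; apply: eq_bigr => j _.
rewrite big_ord1 linearZ /= -deriveE // derive_mx; last exact: diff_derivable.
by rewrite !mxE mulrC.
Qed.

(** The relation between [y] and [x] is asked on [I] only, since the circuit equations hold only
    there. *)
Lemma ddt_comp I n p (F : 'cV[R]_n -> 'cV[R]_p) (x : R -> 'cV[R]_n)
    (y : R -> 'cV[R]_p) t : time_interval I -> I t ->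
  (forall s, I s -> y s = F (x s)) -> differentiable F (x t) ->
  derivable_on I x t ->
  derivable_on I y t /\ ddt I y t = jac F (x t) *m ddt I x t.
Proof.
move=> itvI It yE dF dx; rewrite -diff_jac //; apply: cvg_ddt => //.
apply: (@eq_cvg_diff_quot _ _ (F \o x)) => //; first by move=> s /yE.
exact: cvg_diff_quot_comp.
Qed.

Lemma ddt_mulmx I n p (A : 'M[R]_(p, n)) (x : R -> 'cV[R]_n) t :
  time_interval I -> I t -> derivable_on I x t ->
  derivable_on I (fun s => A *m x s) t
  /\ ddt I (fun s => A *m x s) t = A *m ddt I x t.
Proof.
move=> itvI It dx; apply: cvg_ddt => //.
rewrite (_ : diff_quot _ t = mulmx A \o diff_quot x t).
  refine (@continuous_cvg _ _ _ _ _ _ (mulmx A) _ _ dx).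
  exact: mulmx_continuous.
by apply/funext => h /=; rewrite /diff_quot /= -mulmxBr scalemxAr.
Qed.

Lemma ddt_zero I n (x : R -> 'cV[R]_n) t : time_interval I -> I t ->
  (forall s, I s -> x s = 0) -> ddt I x t = 0.
Proof.
move=> itvI It x0; apply: (cvg_ddt itvI It _).2.
apply: (@eq_cvg_diff_quot _ _ (cst 0)) => //; first by move=> s Is; rewrite x0.
rewrite (_ : diff_quot _ t = cst 0); first exact: cvg_cst.
by apply/funext => h; rewrite /diff_quot subrr scaler0.
Qed.

End RelativeTimeDerivative.

(** * Kirchhoff's laws from the Dirac structure, and the splitting of the sources *)

Lemma circuit_diracP (R : realType) (N mR mL mC mS : nat)
    (A_R : 'M[R]_(N, mR)) (A_L : 'M[R]_(N, mL))
    (A_C : 'M[R]_(N, mC)) (A_S : 'M[R]_(N, mS))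
    (j phi : 'cV[R]_N) (v_L i_L : 'cV[R]_mL) (j_C u_C : 'cV[R]_mC)
    (j_R u_R : 'cV[R]_mR) (j_S u_S : 'cV[R]_mS) :
  circuit_dirac A_R A_L A_C A_S
    (col5 j v_L j_C j_R j_S, col5 phi i_L u_C u_R u_S) <->
  [/\ j + A_C *m j_C + A_R *m j_R + A_S *m j_S = A_L *m i_L,
      u_R = A_R^T *m phi, v_L = - (A_L^T *m phi),
      u_C = A_C^T *m phi & u_S = A_S^T *m phi].
Proof.
rewrite /circuit_dirac /= /dirac_flow_mx /dirac_effort_mx /col5 /row5 /row4.
rewrite !mul_col_mx !mul_row_col !add_col_mx.
rewrite !(mul0mx, mul1mx, mulNmx, addr0, add0r, oppr0).
split.
- move=> /eqP; rewrite !col_mx_eq0 -!addrA.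
  (* The block rows are the current law, then the voltage laws of the conductances, inductances,
     capacitances and sources. *)
  case/and5P => /eqP e1 /eqP e2 /eqP e3 /eqP e4 /eqP e5.
  split.
  + by apply/eqP; rewrite -subr_eq0 -!addrA e1.
  + by apply/esym/eqP; rewrite -subr_eq0 -oppr_eq0 opprB addrC e2.
  + by apply/eqP; rewrite -subr_eq0 -oppr_eq0 opprD opprK -e3.
  + by apply/esym/eqP; rewrite -subr_eq0 -oppr_eq0 opprB addrC e4.
  + by apply/esym/eqP; rewrite -subr_eq0 -oppr_eq0 opprB addrC e5.
- case=> e1 -> -> -> ->.
  by rewrite !addrA e1 opprK !subrr !addNr !col_mx0.
Qed.

(** The dimension [mS] equals [mI + mV] only through a proof, so the split source blocks carry
    casts; these cancel along the shared dimension. *)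
Lemma mul_castmx_inner (R : realType) m p q n (e : p = q)
    (A : 'M[R]_(m, p)) (B : 'M[R]_(p, n)) :
  castmx (erefl, e) A *m castmx (e, erefl) B = A *m B.
Proof. by case: _ / e. Qed.

Lemma castmx_row_tr_mul_eq (R : realType) m p1 p2 q n (e : (p1 + p2)%N = q)
    (A1 : 'M[R]_(m, p1)) (A2 : 'M[R]_(m, p2)) (x : 'M[R]_(m, n))
    (y1 : 'M[R]_(p1, n)) (y2 : 'M[R]_(p2, n)) :
  castmx (e, erefl) (col_mx y1 y2) = (castmx (erefl, e) (row_mx A1 A2))^T *m x ->
  y1 = A1^T *m x /\ y2 = A2^T *m x.
Proof.
by case: _ / e; rewrite !castmx_id tr_row_mx mul_col_mx => /eq_col_mx[-> ->].
Qed.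

Theorem mainTheorem4 (R : realType) (n mR mL mC mS : nat)
  (G : digraph n (mR + (mL + (mC + mS)))%N) (S : {set 'I_n})
  (groundS : grounding G S)
  (A_R : 'M[R]_(#|~: S|, mR)) (A_L : 'M[R]_(#|~: S|, mL))
  (A_C : 'M[R]_(#|~: S|, mC)) (A_S : 'M[R]_(#|~: S|, mS))
  (defA : reduced_incidence G R S = row4 A_R A_L A_C A_S)
  (g : 'cV[R]_mR -> 'cV[R]_mR)
  (g_passive : forall u : 'cV[R]_mR, 0 <= (u^T *m g u) 0 0)
  (H_L : 'cV[R]_mL -> R) (C1_H_L : C1_scalar H_L)
  (H_C : 'cV[R]_mC -> R) (C1_H_C : C1_scalar H_C)
  (I : set R) (intervalI : time_interval I)
  (q : R -> 'cV[R]_#|~: S|) (psi_L : R -> 'cV[R]_mL) (q_C : R -> 'cV[R]_mC)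
  (phi : R -> 'cV[R]_#|~: S|) (i_L : R -> 'cV[R]_mL) (u_C : R -> 'cV[R]_mC)
  (i_R u_R : R -> 'cV[R]_mR) (i_S u_S : R -> 'cV[R]_mS)
  (dyn : satisfies_dynamics I (circuit_dirac A_R A_L A_C A_S)
           (circuit_lagrange H_L H_C) (circuit_resistive g)
           q psi_L q_C phi i_L u_C i_R u_R i_S u_S) :
  (* (a) *)
  (forall t, I t ->
    [/\ A_C *m ddt I q_C t + A_R *m g (A_R^T *m phi t) + A_L *m i_L t
          + A_S *m i_S t = 0,
        - (A_L^T *m phi t) + ddt I psi_L t = 0,
        - (A_S^T *m phi t) + u_S t = 0,
        A_C^T *m phi t - grad H_C (q_C t) = 0
      & i_L t - grad H_L (psi_L t) = 0])
  /\
  (forall (Q_C : 'cV[R]_mC -> 'cV[R]_mC) (Psi_L : 'cV[R]_mL -> 'cV[R]_mL),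
    C1 (grad H_C) -> C1 (grad H_L) ->
    homeomorphism_with_inverse (grad H_C) Q_C ->
    homeomorphism_with_inverse (grad H_L) Psi_L ->
    (* (b), charges and fluxes *)
    (forall t, I t -> q_C t = Q_C (u_C t) /\ psi_L t = Psi_L (i_L t))
    /\
    (forall (mI mV : nat) (defmS : (mI + mV)%N = mS)
       (A_I : 'M[R]_(#|~: S|, mI)) (A_V : 'M[R]_(#|~: S|, mV))
       (u_I i_I : R -> 'cV[R]_mI) (u_V i_V : R -> 'cV[R]_mV),
      A_S = castmx (erefl, defmS) (row_mx A_I A_V) ->
      (forall t, I t -> u_S t = castmx (defmS, erefl) (col_mx (u_I t) (u_V t))) ->
      (forall t, I t -> i_S t = castmx (defmS, erefl) (col_mx (i_I t) (i_V t))) ->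
      (* (b), charge/flux-oriented modified nodal analysis *)
      (forall t, I t ->
        [/\ A_C *m ddt I q_C t + A_R *m g (u_R t) + A_L *m i_L t
              + A_I *m i_I t + A_V *m i_V t = 0,
            - (A_L^T *m phi t) + ddt I psi_L t = 0,
            - (A_V^T *m phi t) + u_V t = 0,
            q_C t - Q_C (A_C^T *m phi t) = 0
          & psi_L t - Psi_L (i_L t) = 0])
      /\
      (* (c), modified nodal analysis *)
      (C1 Q_C -> C1 Psi_L ->
       forall t, I t ->
        [/\ derivable_on I phi t ->
            A_C *m jac Q_C (A_C^T *m phi t) *m A_C^T *m ddt I phi t
              + A_R *m g (A_R^T *m phi t) + A_L *m i_L t
              + A_I *m i_I t + A_V *m i_V t = 0,
            derivable_on I i_L t
              /\ - (A_L^T *m phi t) + jac Psi_L (i_L t) *m ddt I i_L t = 0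
          & - (A_V^T *m phi t) + u_V t = 0]))).
Proof.
have facts t : I t ->
  [/\ A_C *m ddt I q_C t + A_R *m g (u_R t) + A_L *m i_L t + A_S *m i_S t = 0,
      u_R t = A_R^T *m phi t, ddt I psi_L t = A_L^T *m phi t,
      u_C t = A_C^T *m phi t & u_S t = A_S^T *m phi t].
  move=> It; have [_ /circuit_diracP[e1 e2 e3 e4 e5] _ iR] := dyn t It.
  split=> //; last by apply: oppr_inj.
  have q0 : ddt I q t = 0.
    by apply: ddt_zero => // s /dyn[_ _ []].
  (* The resistive relation contains [- i_R], hence the double negation. *)
  have <- : i_R t = g (u_R t) by rewrite -[LHS]opprK; exact: iR.
  move: e1; rewrite q0 oppr0 add0r !mulmxN -!opprD => <-.
  by rewrite addrAC subrr.
have charges t : I t -> u_C t = grad H_C (q_C t) by move=> /dyn[_ _ []].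
have fluxes t : I t -> i_L t = grad H_L (psi_L t) by move=> /dyn[_ _ []].
split.
  move=> t It; have [e1 e2 e3 e4 e5] := facts t It.
  by rewrite -e2 -e3 -e4 -e5 -charges // -fluxes // !addNr !subrr.
move=> Q_C Psi_L _ [dgradH_L _] [_ _ gradCK _] [_ _ gradLK _].
have qE t : I t -> q_C t = Q_C (u_C t) by move=> It; rewrite charges.
have psiE t : I t -> psi_L t = Psi_L (i_L t) by move=> It; rewrite fluxes.
split; first by move=> t It; split; [exact: qE|exact: psiE].
move=> mI mV defmS A_I A_V u_I i_I u_V i_V A_SE u_SE i_SE.
have nodal t : I t ->
    A_C *m ddt I q_C t + A_R *m g (u_R t) + A_L *m i_L t
      + A_I *m i_I t + A_V *m i_V t = 0.
  move=> It; have [<- _ _ _ _] := facts t It.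
  by rewrite i_SE // A_SE mul_castmx_inner mul_row_col !addrA.
have voltage t : I t -> - (A_V^T *m phi t) + u_V t = 0.
  move=> It; have [_ _ _ _] := facts t It.
  by rewrite u_SE // A_SE => /castmx_row_tr_mul_eq[_ ->]; rewrite addNr.
split.
  move=> t It; have [_ _ e3 e4 _] := facts t It.
  by rewrite nodal // voltage // -e3 -e4 -qE // -psiE // addNr !subrr.
move=> [dQ_C _] [dPsi_L _] t It; have [_ e2 e3 e4 _] := facts t It.
split; last exact: voltage.
  move=> dphi; have [du ddtu] := ddt_mulmx A_C^T intervalI It dphi.
  (* Replacing the zero by the nodal equation of (b) leaves the two sides differing only in the
     capacitive term, where the chain rule identifies them. *)
  rewrite -e2 -(nodal t It) -!mulmxA -ddtu.
  have q_CE s : I s -> q_C s = Q_C (A_C^T *m phi s).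
    by move=> Is; have [_ _ _ <- _] := facts s Is; exact: qE.
  by have [_ <-] := ddt_comp intervalI It q_CE (dQ_C _) du.
have [[_ dpsi _] _ _ _] := dyn t It.
(* This use of the chain rule supplies only the differentiability of [i_L]; the one through [Psi_L]
   below gives the equation. *)
have [di_L _] := ddt_comp intervalI It fluxes (dgradH_L _) dpsi.
split=> //; rewrite -e3.
by have [_ <-] := ddt_comp intervalI It psiE (dPsi_L _) di_L; rewrite addNr.
Qed.
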